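(* Let $W_\infty\in\mathcal W_v$ satisfy $W_\infty>0$ Lebesgue-a.e. and $\mathcal V[W_\infty](x)=1$ for Lebesgue-a.e. $x\in[0,1]$. For $\theta\ge0$, $\boldsymbol h\in\mathbb R^c$ let $(\ast)_{\theta,\boldsymbol h}$ denote the optimization problem $$\sup_{\boldsymbol f\in\mathcal F_c}\left\{\theta\sum_{r=1}^cG_{W_\infty,\mathbf 1_r}(\boldsymbol f)+\sum_{r=1}^c h_r\int_0^1 f_r(u)\,du-\int_0^1\sum_{r=1}^c f_r(u)\log f_r(u)\,du\right\}-\log c$$ (i.e. $\alpha_r=\theta$ for all $r\in[c]$), and set $\mu_r:=e^{h_r}/\sum_{s=1}^ce^{h_s}$. Then the following hold. (i) Let $\boldsymbol h$ be such that $h_1\ge\eta+\max_{2\le r\le c}h_r$, where $\eta=\eta(c,v)>0$ is the constant described in the context. For every $\theta\ge0$ let $(x_{\theta,\boldsymbol h,1},\ldots,x_{\theta,\boldsymbol h,c})$ be the unique optimizer of $(\ast)_{\theta,\boldsymbol h}$. Then for $t\in\big[\sum_{r=1}^c\mu_r^v,1\big)$ the good rate function $I_{W_\infty,(1,\ldots,1)}$ simplifies to $$I_{W_\infty,(1,\ldots,1)}(t)=\sum_{r=1}^c x_{\theta_t,\boldsymbol h,r}\log\frac{x_{\theta_t,\boldsymbol h,r}}{\mu_r},$$ where $\theta_t\ge0$ denotes the unique solution (in $\theta\geq 0$) of $\sum_{r=1}^c x_{\theta,\boldsymbol h,r}^v=t$. (ii) Let $h_r=0$ for all $r\in[c]$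 and let $\theta_{\rm crit}\in(0,\infty)$ be the threshold described in the context. For $\theta>\theta_{\rm crit}$ let $(x_{\theta,1},\ldots,x_{\theta,c})$ be the unique optimizer of $(\ast)_{\theta,\boldsymbol 0}$ with $x_{\theta,1}>\max_{2\le r\le c}x_{\theta,r}$. Let $y:=\lim_{\theta\downarrow\theta_{\rm crit}}\sum_{r=1}^c x_{\theta,r}^v$. Then for $t\in(y,1)$, $$I_{W_\infty,(1,\ldots,1)}(t)=\sum_{r=1}^c x_{\theta_t,r}\log\frac{x_{\theta_t,r}}{\mu_r},$$ where $\theta_t>\theta_{\rm crit}$ denotes the unique solution of $\sum_{r=1}^c x_{\theta,r}^v=t$ (and $\mu_r=1/c$).
   Context: Integers $c,v\ge2$ are fixed and $[m]:=\{1,\ldots,m\}$. $\mathcal W_v$ is the space of symmetric real-valued functions in $L^1([0,1]^v)$. $\mathcal F_c$ is the set of measurable $\boldsymbol f=(f_1,\ldots,f_c):[0,1]\to[0,1]^c$ with $\sum_{r=1}^c f_r(x)=1$ for all $x$ (modulo a.e. equality). For $W\in\mathcal W_v$, $$G_{W,\mathbf 1_r}(\boldsymbol f):=\int_{[0,1]^v}W(x_1,\ldots,x_v)\prod_{a=1}^v f_r(x_a)\,dx_1\cdots dx_v,\qquad\mathcal V[W](x):=\int_{[0,1]^{v-1}}W(x,x_2,\ldots,x_v)\prod_{a=2}^v dx_a.$$ The rate function is, for given $\boldsymbol h$, $$I_{W_\infty,(1,\ldots,1)}(t):=\inf_{\boldsymbol f\in\mathcal F_c:\ \sum_{r=1}^cG_{W_\infty,\mathbf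 1_r}(\boldsymbol f)=t}\left\{\int_0^1\sum_{r=1}^c f_r(u)\log f_r(u)\,du-\sum_{r=1}^c h_r\int_0^1 f_r(u)\,du\right\}+\log\sum_{s=1}^c e^{h_s}.$$ Under the hypotheses on $W_\infty$ with $\theta\ge0$, all maximizers of $(\ast)_{\theta,\boldsymbol h}$ are a.e. constant and are identified with probability vectors. The constant $\eta(c,v)$: a constant $\eta>0$, depending only on $c,v$ (it exists, by an earlier result of the paper), such that for every $\theta\ge0$ and every $\boldsymbol h$ with $h_1\ge\eta+\max_{2\le r\le c}h_r$, problem $(\ast)_{\theta,\boldsymbol h}$ has a unique maximizer $(x_{\theta,\boldsymbol h,1},\ldots,x_{\theta,\boldsymbol h,c})$, it satisfies $x_{\theta,\boldsymbol h,1}>\max_{2\le r\le c}x_{\theta,\boldsymbol h,r}$, and it depends continuously on $(\theta,\boldsymbol h)$. The threshold $\theta_{\rm crit}$: the number in $(0,\infty)$ (it exists, by an earlier result of the paper) such that for $\theta<\theta_{\rm crit}$ the vector $(1/c,\ldots,1/c)$ is the unique optimizer of $(\ast)_{\theta,\boldsymbol 0}$, while for $\theta>\theta_{\rm crit}$ there are exactly $c$ distinct optimizers, none uniform, exactly one of which satisfies $x_{\theta,1}>\max_{2\le r\le c}x_{\theta,r}$, and the latter is continuous in $\theta\in(\theta_{\rm crit},\infty)$. Convention: $0\log0=0$, $\inf\emptyset=+\infty$. *)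

(* Defs.v *)
From HB Require Import structures.
From mathcomp Require Import all_boot all_order all_algebra all_fingroup.
From mathcomp Require Import all_classical all_reals all_analysis.

Set Implicit Arguments.
Unset Strict Implicit.
Unset Printing Implicit Defensive.
Import Order.TTheory GRing.Theory Num.Theory.
Import numFieldNormedType.Exports.
Local Open Scope classical_set_scope.
Local Open Scope ring_scope.

(* Functions on [0,1] and on [0,1]^n are represented by Borel functions on R and
   on n.-tuple R.  The measures below are carried by [0,1] and [0,1]^n, so values
   outside the cube are irrelevant, and every Borel function on the cube extends
   to a Borel function on the whole space. *)

Section unit_interval.
Context {R : realType}.

Definition unit_measure : set (measurableTypeR R) -> \bar R :=
  mrestr lebesgue_measure (measurable_itv `[0%R, 1%R]).

HB.instance Definition _ := Measure.on unit_measure.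

Lemma unit_measure_setT : unit_measure setT = 1%E.
Proof.
by rewrite /unit_measure /mrestr setTI lebesgue_measure_itv/= lte_fin ltr01 sube0.
Qed.

HB.instance Definition _ :=
  Measure_isProbability.Build _ _ _ unit_measure unit_measure_setT.

End unit_interval.
Arguments unit_measure : clear implicits.

Section unit_cube.
Context {R : realType}.
Let T := measurableTypeR R.

Definition tuple_cons n (p : T * n.-tuple T) : n.+1.-tuple T :=
  [the n.+1.-tuple T of p.1 :: p.2].

Lemma measurable_tuple_cons n : measurable_fun setT (@tuple_cons n).
Proof. exact: measurable_cons. Qed.

HB.instance Definition _ n :=
  isMeasurableFun.Build _ _ _ _ (@tuple_cons n) (@measurable_tuple_cons n).

(* Lebesgue measure on [0,1]^n *)
Fixpoint cube_measure n : probability (n.-tuple T) R :=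
  match n with
  | 0 => \d_([tuple] : 0.-tuple T)
  | m.+1 => distribution (unit_measure R \x cube_measure m)%E (@tuple_cons m)
  end.

End unit_cube.
Arguments cube_measure : clear implicits.

Section potts.
Context {R : realType}.
Local Notation lambda := (unit_measure R).

Section kernel.
Variable v : nat.
Implicit Types W : v.-tuple R -> R.

(* Elements of L^1 are classes modulo a.e. equality, hence a.e. symmetry. *)
Definition symmetric_L1 W : Prop :=
  (cube_measure R v).-integrable setT (EFin \o W) /\
  forall s : {perm 'I_v},
    {ae cube_measure R v, forall x, W [tuple tnth x (s i) | i < v] = W x}.

Definition one_marginal W (x : R) : \bar R :=
  (\int[cube_measure R v.-1]_y (W [tuple nth 0%R (x :: y) i | i < v])%:E)%E.

Definition admissible W : Prop :=
  [/\ symmetric_L1 W,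
      {ae cube_measure R v, forall x, 0 < W x} &
      {ae lambda, forall x, one_marginal W x = 1%E}].

Definition hom_density W (f : R -> R) : R :=
  \int[cube_measure R v]_x (W x * \prod_(a < v) f (tnth x a)).

End kernel.

Section problem.
Variables c v : nat.
Implicit Types (W : v.-tuple R -> R) (f g : 'I_c -> R -> R) (h x : 'rV[R]_c).

Definition frac_partition f : Prop :=
  [/\ forall r, measurable_fun [set: R] (f r),
      forall r u, u \in `[0, 1] -> 0 <= f r u <= 1 &
      forall u, u \in `[0, 1] -> \sum_(r < c) f r u = 1].

(* The library has ln 0 = 0, so 0 * ln 0 = 0. *)
Definition neg_entropy f : R := \int[lambda]_u \sum_(r < c) f r u * ln (f r u).

Definition field_term h f : R := \sum_(r < c) h ord0 r * \int[lambda]_u f r u.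

Definition hom_sum W f : R := \sum_(r < c) hom_density W (f r).

Definition objective W (theta : R) h f : R :=
  theta * hom_sum W f + field_term h f - neg_entropy f - ln c%:R.

Definition maximizer W theta h f : Prop :=
  frac_partition f /\
  forall g, frac_partition g -> objective W theta h g <= objective W theta h f.

Definition ae_same f g : Prop := {ae lambda, forall u, forall r, f r u = g r u}.

Definition const_partition x : 'I_c -> R -> R := fun r _ => x ord0 r.

(* x is a maximizer, seen as a constant function; in particular it is a
   probability vector. *)
Definition maximizing_vector W theta h x : Prop :=
  maximizer W theta h (const_partition x).

Definition all_maximizers_constant W theta h : Prop :=
  forall f, maximizer W theta h f -> exists x, ae_same f (const_partition x).

Definition unique_maximizer W theta h x : Prop :=
  maximizing_vector W theta h x /\
  forall f, maximizer W theta h f -> ae_same f (const_partition x).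

(* Index 1 of the mathematical text is the element of 'I_c with value 0. *)
Definition first_largest x : Prop :=
  forall r s : 'I_c, val r = 0%N -> val s <> 0%N -> x ord0 s < x ord0 r.

Definition first_exceeds_by (eta : R) h : Prop :=
  forall r s : 'I_c, val r = 0%N -> val s <> 0%N -> eta + h ord0 s <= h ord0 r.

Definition threshold W (theta_crit : R) : Prop :=
  [/\ 0 < theta_crit,
      forall theta, 0 <= theta < theta_crit ->
        unique_maximizer W theta 0 (const_mx c%:R^-1),
      forall theta, theta_crit < theta ->
        [/\ all_maximizers_constant W theta 0,
            ([set x | maximizing_vector W theta 0 x] #= `I_c)%card,
            ~ maximizing_vector W theta 0 (const_mx c%:R^-1) &
            exists! x, maximizing_vector W theta 0 x /\ first_largest x] &
      exists x : R -> 'rV[R]_c,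
        (forall theta, theta_crit < theta ->
          maximizing_vector W theta 0 (x theta) /\ first_largest (x theta)) /\
        {within `]theta_crit, +oo[, continuous x}].

Definition base_measure h (r : 'I_c) : R :=
  expR (h ord0 r) / \sum_(s < c) expR (h ord0 s).

Definition rel_entropy x h : R :=
  \sum_(r < c) x ord0 r * ln (x ord0 r / base_measure h r).

Definition power_sum x : R := \sum_(r < c) x ord0 r ^+ v.

(* ereal_inf set0 = +oo *)
Definition rate_function W h (t : R) : \bar R :=
  (ereal_inf [set (neg_entropy f - field_term h f)%:E
               | f in [set f | frac_partition f /\ hom_sum W f = t]]
   + (ln (\sum_(s < c) expR (h ord0 s)))%:E)%E.

End problem.

(* eta is a property of (c, v) alone: it is uniform in the kernel W. *)
Definition dominance_constant (c v : nat) (eta : R) : Prop :=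
  0 < eta /\
  forall W : v.-tuple R -> R, admissible W ->
  exists x : R * 'rV[R]_c -> 'rV[R]_c,
    (forall theta h, 0 <= theta -> first_exceeds_by eta h ->
      unique_maximizer W theta h (x (theta, h)) /\ first_largest (x (theta, h)))
    /\ {within [set p | 0 <= p.1 /\ first_exceeds_by eta p.2], continuous x}.

End potts.

(* Main.v *)
(* Weak duality: if x maximizes the problem at theta and S(x) = sum_r x_r^v, then
   comparing x with any f such that hom_sum f = S(x) shows that x attains the
   infimum defining I(S(x)), so I(S(x)) is the relative entropy of x.  It remains
   to solve S(x_theta) = t.  S(x_theta) is nondecreasing by comparing the maximizers
   at two values of theta, and strictly so: otherwise one non-uniform vector would
   satisfy the first-order condition
     theta v (x_1^(v-1) - x_r^(v-1)) + h_1 - h_r = ln x_1 - ln x_r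
   for two values of theta.  It is continuous, and tends to 1 by comparison with a
   vertex of the simplex.  In (i) the first-order condition at theta = 0 gives
   x_0 = mu, hence S(x_0) = sum_r mu_r^v. *)
Require Import Defs.
From mathcomp Require Import all_boot all_order all_algebra.
From mathcomp Require Import all_classical all_reals all_analysis.
From mathcomp Require Import measurable_realfun ring lra.
Import Order.TTheory GRing.Theory Num.Theory.
Import numFieldNormedType.Exports.
Local Open Scope classical_set_scope.
Local Open Scope ring_scope.
Set Implicit Arguments.
Unset Strict Implicit.

(** * Total mass of the kernel *)

(** [cube_measure] in dimension [n.+1] is the image of a product under [tuple_cons]; pulling back to
    that product makes Fubini available. *)
Lemma integrable_cube_cons (R : realType) (n : nat) (F : n.+1.-tuple R -> R) :
  (cube_measure R n.+1).-integrable setT (EFin \o F) ->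
  (unit_measure R \x cube_measure R n)%E.-integrable setT
    ((EFin \o F) \o @tuple_cons R n).
Proof.
move=> /integrableP[mF iF]; apply/integrableP; split.
  exact: (measurableT_comp mF (@measurable_tuple_cons R n)).
move: iF; rewrite ge0_integral_pushforward//.
exact: (measurableT_comp (@abse_measurable R setT) mF).
Qed.

(** Fubini with the first coordinate integrated last: the inner integral is the marginal, which is 1
    almost everywhere. *)
Lemma Rintegral_one_marginal (R : realType) {v : nat} (W : v.-tuple R -> R) :
  (0 < v)%N -> (cube_measure R v).-integrable setT (EFin \o W) ->
  {ae unit_measure R, forall x, one_marginal W x = 1%E} ->
  \int[cube_measure R v]_x W x = 1.
Proof.
case: v W => // n W _ iW W1.
have margE x : one_marginal W x =
    (\int[cube_measure R n]_y (W (tuple_cons (x, y)))%:E)%E.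
  apply: eq_integral => y _; congr (W _)%:E; apply: eq_from_tnth => i.
  by rewrite tnth_mktuple (tnth_nth 0).
have iWc := integrable_cube_cons iW.
rewrite /Rintegral (integral_distribution (measurable_int _ iW) iWc).
rewrite -(integral12_prod_meas1 iWc).
rewrite (@ae_eq_integral _ _ _ (unit_measure R) setT (cst 1%E))//.
- by rewrite integral_cst//= probability_setT mul1e.
- exact: (measurable_fubini_F iWc).
- by apply: (@filterS _ _ (ae_filter_ringOfSetsType _) _ _ _ W1) => x + _; rewrite margE.
Qed.

(** * Exchange of mass between two colours *)

(** Share of a single colour in the objective at a constant partition: [u] is the mass of the colour
    and [k] its field. *)
Definition site_gain {R : realType} (v : nat) (theta k u : R) : R :=
  theta * u ^+ v + k * u - u * ln u.

Lemma is_derive_site_gain {R : realType} (v : nat) (theta k u : R) : 0 < u ->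
  is_derive u (1 : R) (site_gain v theta k)
    (theta * (v%:R * u ^+ v.-1) + k - ln u - 1).
Proof.
move=> u0; have dln := is_derive1_ln u0.
have -> : site_gain v theta k =
    theta \*: (id ^+ v) + k \*: id - id * (@ln R) by apply/funext => x; rewrite !fctE.
by apply: is_derive_eq; rewrite /GRing.scale/= mulfV ?gt_eqF//; ring.
Qed.

Lemma exprB_le (R : realType) (n : nat) (a b : R) : 0 <= b -> b <= a -> a <= 1 ->
  a ^+ n - b ^+ n <= n%:R * (a - b).
Proof.
move=> b0 ba a1; elim: n => [|n IH]; first by rewrite !expr0 subrr mul0r.
have bn1 : b ^+ n <= 1 by rewrite exprn_ile1// (le_trans ba).
have abn : 0 <= a ^+ n - b ^+ n by rewrite subr_ge0 lerXn2r// nnegrE (le_trans b0).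
have : a * (a ^+ n - b ^+ n) <= a ^+ n - b ^+ n by rewrite ler_piMl.
have : (a - b) * b ^+ n <= a - b by rewrite ler_piMr// subr_ge0.
rewrite !exprS -natr1; nra.
Qed.

(* At an optimum no coordinate vanishes, since u ln u has slope -oo at 0; hence
   the first-order condition holds. *)
Lemma two_site_stationary (R : realType) (v : nat) (theta k l a b : R) :
  0 <= theta -> 0 <= b -> b < a -> a <= 1 ->
  (forall t, 0 <= t <= a + b ->
    site_gain v.+1 theta k t + site_gain v.+1 theta l (a + b - t) <=
    site_gain v.+1 theta k a + site_gain v.+1 theta l b) ->
  0 < b /\ theta * (v.+1%:R * (a ^+ v - b ^+ v)) + (k - l) = ln a - ln b.
Proof.
move=> th0 b0 ba a1 opt; have a0 : 0 < a by exact: le_lt_trans ba.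
have {b0} b0 : 0 < b.
  rewrite lt_neqAle b0 andbT eq_sym; apply/eqP => bE.
  rewrite {}bE addr0 in opt.
  (* Moving mass [e] to the empty colour costs at most [C * e] and earns [- e * ln e]. With
     [ln e <= - C - 1] the net profit is at least [e], which contradicts optimality; the bound
     [a / 2] keeps [a - e] positive. *)
  pose C := theta * v.+1%:R + (k - l) - ln a.
  pose e := Num.min (a / 2) (expR (- C - 1)).
  have e0 : 0 < e by rewrite lt_min divr_gt0//= expR_gt0.
  have ea : e < a by rewrite gt_min; apply/orP; left; lra.
  have lne : ln e <= - C - 1.
    by rewrite -[leRHS]expRK ler_ln ?posrE ?expR_gt0// ge_min lexx orbT.
  have := opt (a - e); rewrite subKr /site_gain (ln0 (lexx 0)) expr0n/= !mulr0 !addr0 subr0.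
  have ae0 : 0 <= a - e <= a by apply/andP; split; lra.
  move=> /(_ ae0) opt_e.
  have := @exprB_le R v.+1 a (a - e); rewrite subKr.
  move=> /(_ _ _ a1) /(ler_wpM2l th0) exp_e.
  have {}exp_e : theta * (a ^+ v.+1 - (a - e) ^+ v.+1) <=
      theta * (v.+1%:R * e) by apply: exp_e; lra.
  have lnae : (a - e) * ln (a - e) <= (a - e) * ln a.
    by rewrite ler_pM2l ?subr_gt0// ler_ln ?posrE ?subr_gt0//; lra.
  have ev : 0 <= theta * e ^+ v.+1 by rewrite mulr_ge0// exprn_ge0// ltW.
  have eln : e * ln e <= e * (- C - 1) by rewrite ler_pM2l.
  rewrite /C in eln; lra.
split=> //.
pose m := a + b.
(* Gain of the two colours along the segment of constant total mass [m]. Its maximum at the interior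
   point [a] gives a vanishing derivative, which is the first-order condition. *)
pose F := fun t => site_gain v.+1 theta k t + site_gain v.+1 theta l (m - t).
have dF t : 0 < t < m -> is_derive t (1 : R) F
   ((theta * (v.+1%:R * t ^+ v) + k - ln t - 1) -
    (theta * (v.+1%:R * (m - t) ^+ v) + l - ln (m - t) - 1)).
  move=> /andP[t0 tm].
  have d1 := is_derive_site_gain v.+1 theta k t0.
  have mt0 : 0 < m - t by rewrite subr_gt0.
  have d2 := is_derive_site_gain v.+1 theta l mt0.
  have d3 : is_derive t (1 : R) (fun t => m - t) (-1).
    have -> : (fun t => m - t) = cst m - @id R by [].
    by apply: is_derive_eq; rewrite sub0r.
  have d4 := @is_derive1_comp R (site_gain v.+1 theta l) (fun t => m - t) t _ _ d2 d3.
  by apply: is_derive_eq (is_deriveD d1 d4) _; rewrite /=; ring.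
have mE : m - a = b by rewrite /m addrC addKr.
have am : 0 < a < m by rewrite a0 ltrDl.
have dFa : is_derive a (1 : R) F 0.
  apply: (@derive1_at_max R F 0 m a).
  - by rewrite addr_ge0// ltW.
  - by move=> t; rewrite in_itv/= => /dF[].
  - by rewrite in_itv.
  - move=> t; rewrite in_itv/= => /andP[t0 tm].
    by rewrite /F mE; apply: opt; rewrite !ltW.
have [_ E1] := dF a am; have [_] := dFa; rewrite E1 mE; lra.
Qed.

(** * Reduction to probability vectors and weak duality *)

Definition vector_gain {R : realType} {c : nat} (v : nat) (theta : R)
    (h x : 'rV[R]_c) : R :=
  \sum_(r < c) site_gain v theta (h ord0 r) (x ord0 r).

Definition prob_vector {R : realType} {c : nat} (x : 'rV[R]_c) : Prop :=
  (forall r, 0 <= x ord0 r) /\ \sum_(r < c) x ord0 r = 1.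

Definition optimal_vector {R : realType} {c : nat} (v : nat) (theta : R)
    (h x : 'rV[R]_c) : Prop :=
  prob_vector x /\
  forall y, prob_vector y -> vector_gain v theta h y <= vector_gain v theta h x.

Lemma prob_vector_le1 (R : realType) (c : nat) (x : 'rV[R]_c) (r : 'I_c) :
  prob_vector x -> x ord0 r <= 1.
Proof.
by move=> [x0 <-]; rewrite (bigD1 r)//= lerDl sumr_ge0.
Qed.

Lemma frac_partition_const (R : realType) (c : nat) (x : 'rV[R]_c) :
  frac_partition (const_partition x) <-> prob_vector x.
Proof.
split=> [[_ x01 x1]|px].
  have u0 : (0 : R) \in `[0, 1] by rewrite in_itv/= lexx ler01.
  by split=> [r|]; [have /andP[] := x01 r 0 u0|exact: x1 u0].
split=> [r|r u _|u _]; first exact: measurable_cst.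
  by rewrite /const_partition prob_vector_le1// (proj1 px).
exact: (proj2 px).
Qed.

Lemma Rintegral_unit_cst (R : realType) (k : R) :
  \int[unit_measure R]_u k = k.
Proof.
rewrite Rintegral_cst// -[RHS]mulr1; congr (_ * _).
exact: (congr1 fine (@unit_measure_setT R)).
Qed.

Lemma neg_entropy_const (R : realType) (c : nat) (x : 'rV[R]_c) :
  neg_entropy (const_partition x) = \sum_(r < c) x ord0 r * ln (x ord0 r).
Proof. by rewrite /neg_entropy /const_partition Rintegral_unit_cst. Qed.

Lemma field_term_const (R : realType) (c : nat) (h x : 'rV[R]_c) :
  field_term h (const_partition x) = \sum_(r < c) h ord0 r * x ord0 r.
Proof.
by apply: eq_bigr => r _; rewrite /const_partition Rintegral_unit_cst.
Qed.

Lemma hom_sum_const (R : realType) (c v : nat) (W : v.-tuple R -> R)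
    (x : 'rV[R]_c) :
  (0 < v)%N -> admissible W -> hom_sum W (const_partition x) = power_sum v x.
Proof.
move=> v0 [[iW _] _ W1]; apply: eq_bigr => r _; rewrite /hom_density.
under eq_Rintegral do rewrite prodr_const card_ord.
by rewrite RintegralZr// Rintegral_one_marginal// mul1r.
Qed.

Lemma vector_gainE (R : realType) (c v : nat) (theta : R) (h x : 'rV[R]_c) :
  vector_gain v theta h x =
  theta * power_sum v x + \sum_(r < c) h ord0 r * x ord0 r
  - \sum_(r < c) x ord0 r * ln (x ord0 r).
Proof. by rewrite /vector_gain sumrB big_split mulr_sumr. Qed.

Lemma objective_const (R : realType) (c v : nat) (W : v.-tuple R -> R)
    (theta : R) (h x : 'rV[R]_c) :
  (0 < v)%N -> admissible W ->
  objective W theta h (const_partition x) = vector_gain v theta h x - ln c%:R.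
Proof.
move=> v0 aW.
by rewrite /objective hom_sum_const// field_term_const neg_entropy_const vector_gainE.
Qed.

(** Only constant competitors are kept; on these the objective is [vector_gain] up to the constant
    [ln c%:R]. *)
Lemma maximizing_vector_optimal (R : realType) (c v : nat) (W : v.-tuple R -> R)
    (theta : R) (h x : 'rV[R]_c) :
  (0 < v)%N -> admissible W ->
  maximizing_vector W theta h x -> optimal_vector v theta h x.
Proof.
move=> v0 aW [/frac_partition_const px opt]; split=> // y /frac_partition_const.
by move=> /opt; rewrite !objective_const// lerD2r.
Qed.

(** The logarithm of [base_measure h r] is [h ord0 r] minus the log-partition function, and the
    latter factors out because the coordinates sum to 1. *)
Lemma rel_entropyE (R : realType) (c : nat) (h x : 'rV[R]_c) :
  prob_vector x ->
  rel_entropy x h = \sum_(r < c) x ord0 r * ln (x ord0 r)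
    - \sum_(r < c) h ord0 r * x ord0 r + ln (\sum_(s < c) expR (h ord0 s)).
Proof.
move=> [x0 x1]; set Z := \sum_(s < c) expR _.
rewrite -[ln Z]mul1r -x1 mulr_suml -sumrB -big_split; apply: eq_bigr => r _.
(* A vanishing coordinate is treated apart, since the logarithm of a quotient splits only for
   positive arguments. *)
have [->|xr0] := eqVneq (x ord0 r) 0; first by rewrite /= !(mul0r, mulr0, subr0, addr0).
have Z0 : 0 < Z.
  by rewrite /Z (bigD1 r)//= ltr_wpDr ?expR_gt0// sumr_ge0// => s _; exact: expR_ge0.
rewrite /base_measure -/Z !ln_div ?posrE ?divr_gt0 ?expR_gt0//; last first.
  by rewrite lt_neqAle eq_sym xr0 x0.
by rewrite expRK/=; ring.
Qed.

Lemma rate_function_maximizer (R : realType) (c v : nat) (W : v.-tuple R -> R)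
    (theta : R) (h x : 'rV[R]_c) :
  (0 < v)%N -> admissible W -> maximizing_vector W theta h x ->
  rate_function W h (power_sum v x) = (rel_entropy x h)%:E.
Proof.
move=> v0 aW [fx opt]; have px := (frac_partition_const _).1 fx.
rewrite rel_entropyE// EFinD /rate_function; congr (_ + _)%E.
rewrite -neg_entropy_const -field_term_const.
apply/eqP; rewrite eq_le; apply/andP; split.
  by apply: ereal_inf_lbound; exists (const_partition x) => //; rewrite /= hom_sum_const.
(* A feasible [f] has the same [hom_sum] as [x], so the [theta] terms cancel and optimality compares
   only entropy and field. *)
apply: le_ereal_inf_tmp => _ [f [ff fE] <-]; rewrite lee_fin.
by have := opt f ff; rewrite /objective fE hom_sum_const//; lra.
Qed.

(** * Consequences of the first-order condition *)

Lemma optimal_vector_stationary (R : realType) (c v : nat) (theta : R)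
    (h x : 'rV[R]_c) (i j : 'I_c) :
  0 <= theta -> optimal_vector v.+1 theta h x -> x ord0 j < x ord0 i ->
  0 < x ord0 j /\
  theta * (v.+1%:R * (x ord0 i ^+ v - x ord0 j ^+ v)) + (h ord0 i - h ord0 j) =
  ln (x ord0 i) - ln (x ord0 j).
Proof.
move=> th0 [px opt] xji; have [x0 x1] := px.
have ji : j != i by apply: contraTneq xji => ->; rewrite ltxx.
apply: two_site_stationary => //; first exact: prob_vector_le1.
move=> t /andP[t0 tab].
(* Redistribute the joint mass of [i] and [j], leaving the other coordinates alone; this is the
   variation required by [two_site_stationary]. *)
pose y := \row_r (if r == i then t
                  else if r == j then x ord0 i + x ord0 j - t else x ord0 r).
have sumE (F : 'I_c -> R -> R) : \sum_r F r (y ord0 r) =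
    F i t + F j (x ord0 i + x ord0 j - t) +
    \sum_(r < c | (r != i) && (r != j)) F r (x ord0 r).
  rewrite (bigD1 i)//= (bigD1 j)//= !mxE eqxx (negbTE ji) eqxx addrA.
  congr (_ + _); apply: eq_bigr => r /andP[ri rj].
  by rewrite mxE (negbTE ri) (negbTE rj).
have py : prob_vector y.
  split=> [r|].
    by rewrite mxE; case: ifP => // _; case: ifP => // _; rewrite subr_ge0.
  rewrite (sumE (fun=> id)) -[RHS]x1 [RHS](bigD1 i)//= [X in _ = _ + X](bigD1 j)//=.
  ring.
have := opt y py.
rewrite /vector_gain (sumE (fun r => site_gain v.+1 theta (h ord0 r))).
by rewrite [leRHS](bigD1 i)//= [X in _ <= _ + X](bigD1 j)//=; lra.
Qed.

Lemma power_sum_strictly_increasing (R : realType) (c v : nat) (th1 th2 : R)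
    (h x1 x2 : 'rV[R]_c) (i j : 'I_c) :
  0 <= th1 -> th1 < th2 ->
  optimal_vector v.+2 th1 h x1 -> optimal_vector v.+2 th2 h x2 ->
  x1 ord0 j < x1 ord0 i -> power_sum v.+2 x1 < power_sum v.+2 x2.
Proof.
move=> th10 th12 opt1 opt2 x1ji; rewrite ltNge; apply/negP => S21.
have shift x : vector_gain v.+2 th2 h x =
    vector_gain v.+2 th1 h x + (th2 - th1) * power_sum v.+2 x.
  by rewrite !vector_gainE; ring.
(* By [shift], going from [th1] to [th2] rewards a larger power sum. If that of [x1] is at least
   that of [x2], then [x1] stays optimal at [th2], and its two first-order conditions are
   incompatible. *)
have opt12 : optimal_vector v.+2 th2 h x1.
  have [px1 le1] := opt1; have [px2 le2] := opt2.
  split=> // y /le2 /le_trans; apply; rewrite !shift lerD ?le1//.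
  by rewrite ler_pM2l ?subr_gt0.
have [xj0 E1] := optimal_vector_stationary th10 opt1 x1ji.
have [_ E2] := optimal_vector_stationary (ltW (le_lt_trans th10 th12)) opt12 x1ji.
have pow : 0 < x1 ord0 i ^+ v.+1 - x1 ord0 j ^+ v.+1.
  by rewrite subr_gt0 ltrXn2r// ltW.
have : 0 < (th2 - th1) * (v.+2%:R * (x1 ord0 i ^+ v.+1 - x1 ord0 j ^+ v.+1)).
  by rewrite mulr_gt0 ?subr_gt0// mulr_gt0.
by rewrite mulrBl; lra.
Qed.

(* Comparison with the vertex of the simplex at [i]. *)
Lemma power_sum_near1 (R : realType) (c v : nat) (h : 'rV[R]_c) (i : 'I_c) :
  exists K : R, forall theta x, optimal_vector v.+1 theta h x ->
    theta * (1 - power_sum v.+1 x) <= K.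
Proof.
exists (\sum_(r < c) (`|h ord0 r| + 1) - h ord0 i) => theta x [px opt].
have [x0 x1] := px.
pose e : 'rV[R]_c := \row_r (r == i)%:R.
have pe : prob_vector e.
  split=> [r|]; first by rewrite mxE ler0n.
  rewrite (bigD1 i)//= mxE eqxx big1 ?addr0// => r ri.
  by rewrite mxE (negbTE ri).
have gainE : vector_gain v.+1 theta h e = theta + h ord0 i.
  rewrite /vector_gain (bigD1 i)//= big1 => [|r ri].
    by rewrite mxE eqxx /site_gain ln1 expr1n !mulr1 mulr0 subr0 addr0.
  by rewrite mxE (negbTE ri) /site_gain expr0n/= !mulr0 mul0r !addr0 subr0.
have := opt e pe; rewrite gainE vector_gainE.
(* Field and entropy stay bounded independently of [theta]: each entropy term is at most 1, as [ln]
   of the inverse of [x ord0 r] is below that inverse. *)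
have : \sum_(r < c) h ord0 r * x ord0 r - \sum_(r < c) x ord0 r * ln (x ord0 r)
    <= \sum_(r < c) (`|h ord0 r| + 1).
  rewrite -sumrB; apply: ler_sum => r _; apply: lerD.
    rewrite (le_trans (ler_norm _))// normrM ler_piMr// ger0_norm//.
    exact: prob_vector_le1.
  have [->|xr0] := eqVneq (x ord0 r) 0; first by rewrite mul0r oppr0.
  have {}xr0 : 0 < x ord0 r by rewrite lt_neqAle eq_sym xr0 x0.
  rewrite -mulrN -lnV ?posrE// -[leRHS](mulfV (lt0r_neq0 xr0)) ler_pM2l//.
  by rewrite ltW// ln_sublinear// invr_gt0.
lra.
Qed.

(** Without interaction the first-order condition makes every coordinate proportional to
    [expR (h ord0 r)]; the total mass 1 fixes the factor [K]. *)
Lemma optimal_vector_theta0 (R : realType) (c v : nat) (h x : 'rV[R]_c)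
    (i : 'I_c) :
  optimal_vector v.+1 0 h x -> (forall j, j != i -> x ord0 j < x ord0 i) ->
  forall r, x ord0 r = base_measure h r.
Proof.
move=> opt xi; have [[x0 x1] _] := opt.
pose K := x ord0 i / expR (h ord0 i).
have xE r : x ord0 r = expR (h ord0 r) * K.
  have [->|ri] := eqVneq r i; first by rewrite /K mulrC divfK ?gt_eqF ?expR_gt0.
  have [xr0] := optimal_vector_stationary (lexx 0) opt (xi _ ri).
  rewrite mul0r add0r => E.
  have xi0 : 0 < x ord0 i := lt_trans xr0 (xi r ri).
  rewrite /K -[x ord0 i]lnK ?posrE// -[LHS]lnK ?posrE//.
  by rewrite -expRN -!expRD; congr expR; lra.
move: x1; under eq_bigr do rewrite xE.
rewrite -mulr_suml => ZK r; rewrite xE /base_measure; congr (_ * _).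
set Z := \sum_(_ < _) _ in ZK *.
have Z0 : Z != 0 by apply: contra_eq_neq ZK => ->; rewrite mul0r eq_sym oner_neq0.
by apply: (mulfI Z0); rewrite ZK mulfV.
Qed.

(** * Solving for the parameter *)

Lemma power_sum_continuous (R : realType) (c v : nat) :
  continuous (@power_sum R c v).
Proof.
have -> : @power_sum R c v = \sum_(r < c) (fun x : 'rV[R]_c => x ord0 r ^+ v).
  by apply/funext => x; rewrite fct_sumE.
elim/big_ind: _ => [|f g cf cg|r _] x; first exact: cst_continuous.
  by apply: continuousD; [exact: cf|exact: cg].
apply: (@continuous_comp _ _ _ (fun y : 'rV[R]_c => y ord0 r) (fun u => u ^+ v)).
  exact: coord_continuous.
exact: exprn_continuous.
Qed.

Lemma power_sum_attained (R : realType) (c v : nat) (h : 'rV[R]_c)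
    (x : R -> 'rV[R]_c) (th0 t : R) (i : 'I_c) :
  (forall theta, th0 <= theta -> optimal_vector v.+1 theta h (x theta)) ->
  {within [set theta | th0 <= theta], continuous x} ->
  power_sum v.+1 (x th0) <= t < 1 ->
  exists2 theta, th0 <= theta & power_sum v.+1 (x theta) = t.
Proof.
move=> opt cx /andP[S0t t1].
have [K Kle] := power_sum_near1 v h i.
(* Chosen so that [b * (1 - t)] exceeds [K] in absolute value: a power sum below [t] at [b] would
   violate [Kle], so the intermediate value theorem applies on [[th0, b]]. *)
pose b := Num.max th0 (`|K| / (1 - t) + 1).
have th0b : th0 <= b by rewrite le_max lexx.
have tSb : t <= power_sum v.+1 (x b).
  rewrite leNgt; apply/negP => Sbt.
  have Kb : `|K| / (1 - t) < b.
    by rewrite lt_max (_ : _ < _ + 1) ?orbT// ltrDl.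
  have b0 : 0 < b by apply: le_lt_trans Kb; rewrite divr_ge0// subr_ge0 ltW.
  have := Kle b (x b) (opt b th0b); apply/negP; rewrite -ltNge.
  apply: (@le_lt_trans _ _ `|K|); first exact: ler_norm.
  apply: (@lt_trans _ _ (b * (1 - t))); first by rewrite -ltr_pdivrMr ?subr_gt0.
  by rewrite ltr_pM2l// ltrD2l ltrN2.
have cS : {within `[th0, b], continuous (@power_sum R c v.+1 \o x)}.
  apply: within_continuous_comp; first by move=> y _; exact: power_sum_continuous.
  apply: continuous_subspaceW cx => theta /=; rewrite in_itv/=.
  by case/andP.
have [|theta] := @IVT R (@power_sum R c v.+1 \o x) th0 b t th0b cS.
  by rewrite ge_min S0t le_max tSb orbT.
by rewrite in_itv/= => /andP[]; exists theta.
Qed.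

(** A property free of the point that holds almost everywhere for a nonzero measure simply holds. *)
Lemma ae_same_const (R : realType) (c : nat) (x y : 'rV[R]_c) :
  ae_same (const_partition x) (const_partition y) -> x = y.
Proof.
move=> xy; apply/rowP => r.
have mu0 : (0 < unit_measure R setT)%E by rewrite unit_measure_setT.
exact: (@filter_const _ _ (ae_properfilter_algebraOfSetsType mu0)
  (forall r, x ord0 r = y ord0 r) xy r).
Qed.

Lemma within_continuous_pair (T U V : topologicalType) (A : set T)
    (B : set (T * U)) (f : T * U -> V) (u : U) :
  (forall x, A x -> B (x, u)) -> {within B, continuous f} ->
  {within A, continuous (fun x => f (x, u))}.
Proof.
move=> AB /subspace_continuousP cf; apply/subspace_continuousP => x Ax.
apply: cvg_comp (cf _ (AB _ Ax)) => P; rewrite /within/= => nP.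
case: nP => -[P1 P2] /= [nP1 nP2] P12.
apply: filterS nP1 => y P1y Ay.
by apply: (P12 (y, u)); [split=> //; exact: nbhs_singleton nP2|exact: AB].
Qed.

Lemma first_largest_gt (R : realType) (c : nat) (x : 'rV[R]_c.+1) (j : 'I_c.+1) :
  first_largest x -> j != ord0 -> x ord0 j < x ord0 ord0.
Proof. by move=> fx j0; apply: fx => //; apply/eqP; apply: contra j0. Qed.

(** Strict monotonicity rules out both orders. With at least two colours, [ord_max] differs from
    [ord0], so a vector with strictly largest first entry is not uniform. *)
Lemma power_sum_inj (R : realType) (c v : nat) (h : 'rV[R]_c.+2)
    (x : R -> 'rV[R]_c.+2) (th1 th2 : R) :
  0 <= th1 -> 0 <= th2 ->
  optimal_vector v.+2 th1 h (x th1) -> optimal_vector v.+2 th2 h (x th2) ->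
  first_largest (x th1) -> first_largest (x th2) ->
  power_sum v.+2 (x th1) = power_sum v.+2 (x th2) -> th1 = th2.
Proof.
move=> th10 th20 opt1 opt2 f1 f2 S12.
have [lt12|lt21|//] := ltgtP th1 th2.
- have := power_sum_strictly_increasing th10 lt12 opt1 opt2
    (first_largest_gt f1 (j := ord_max) isT).
  by rewrite S12 ltxx.
- have := power_sum_strictly_increasing th20 lt21 opt2 opt1
    (first_largest_gt f2 (j := ord_max) isT).
  by rewrite S12 ltxx.
Qed.

Unset Implicit Arguments.
Set Strict Implicit.

Theorem proposition2p12 (R : realType) (c v : nat)
    (hc : (2 <= c)%N) (hv : (2 <= v)%N)
    (W : v.-tuple R -> R) (hW : symmetric_L1 W)
    (Wpos : {ae cube_measure R v, forall x, 0 < W x})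
    (W1 : {ae unit_measure R, forall x, one_marginal W x = 1%E}) :
  (forall (eta : R) (h : 'rV[R]_c) (x : R -> 'rV[R]_c),
     dominance_constant c v eta ->
     first_exceeds_by eta h ->
     (forall theta, 0 <= theta -> unique_maximizer W theta h (x theta)) ->
     forall t : R, \sum_(r < c) base_measure h r ^+ v <= t < 1 ->
     exists theta_t : R,
       [/\ 0 <= theta_t,
           power_sum v (x theta_t) = t,
           forall theta, 0 <= theta -> power_sum v (x theta) = t ->
             theta = theta_t &
           rate_function W h t = (rel_entropy (x theta_t) h)%:E])
  /\
  (forall (theta_crit : R) (x : R -> 'rV[R]_c),
     threshold c W theta_crit ->
     (forall theta, theta_crit < theta ->
        maximizing_vector W theta 0 (x theta) /\ first_largest (x theta)) ->
     let S := fun theta : R => power_sum v (x theta) in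
     let y : R := lim (S theta @[theta --> theta_crit^'+]) in
     cvg (S theta @[theta --> theta_crit^'+]) /\
     forall t : R, y < t < 1 ->
     exists theta_t : R,
       [/\ theta_crit < theta_t,
           power_sum v (x theta_t) = t,
           forall theta, theta_crit < theta -> power_sum v (x theta) = t ->
             theta = theta_t &
           rate_function W (0 : 'rV[R]_c) t = (rel_entropy (x theta_t) 0)%:E]).
Proof.
have aW : admissible W by split.
case: c hc => [|[|{}c]]// _.
case: v hv W hW Wpos W1 aW => [|[|{}v]]// _ W hW Wpos W1 aW.
split=> [eta h x [_ /(_ W aW)[xx [xxP xxc]]] fh xP t /andP[S0t t1]|].
  (* Uniqueness identifies the given maximizers with the continuous selection [xx], from which they
     inherit continuity and the dominance of the first entry. *)
  have xE theta : 0 <= theta -> x theta = xx (theta, h).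
    by move=> th0; apply/ae_same_const/(xxP _ _ th0 fh).1.2/(xP _ th0).1.
  have opt theta : 0 <= theta -> optimal_vector v.+2 theta h (x theta).
    by move=> th0; apply: (maximizing_vector_optimal _ aW) => //; exact: (xP _ th0).1.
  have fx theta : 0 <= theta -> first_largest (x theta).
    by move=> th0; rewrite xE//; exact: (xxP _ _ th0 fh).2.
  have cx : {within [set theta | 0 <= theta], continuous x}.
    have xE' : {in [set theta | 0 <= theta],
        (fun theta => xx (theta, h)) =1 x}.
      by move=> theta; rewrite inE/= => /xE.
    apply: (subspace_eq_continuous xE').
    by apply: within_continuous_pair xxc => theta /= th0; split.
  have S0E : power_sum v.+2 (x 0) = \sum_(r < c.+2) base_measure h r ^+ v.+2.
    apply: eq_bigr => r _; congr (_ ^+ _).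
    apply: optimal_vector_theta0 (opt _ (lexx 0)) _ _ => j.
    exact: first_largest_gt (fx _ (lexx 0)).
  have [|theta th0 Sth] := @power_sum_attained _ _ v.+1 h x 0 t ord0 opt cx.
    by rewrite S0E S0t.
  exists theta; split=> // [theta' th0' Sth'|].
    apply: (power_sum_inj th0' th0 (opt _ th0') (opt _ th0)).
    - exact: fx th0'.
    - exact: fx th0.
    - by rewrite Sth'.
  by rewrite -Sth; apply: rate_function_maximizer (xP _ th0).1.
move=> tc x [tc0 _ above [xx [xxP xxc]]] xP S y.
have pos theta : tc < theta -> 0 <= theta by move=> /(lt_trans tc0)/ltW.
have opt theta : tc < theta -> optimal_vector v.+2 theta 0 (x theta).
  by move=> /xP[mx _]; exact: maximizing_vector_optimal mx.
have fx theta : tc < theta -> first_largest (x theta) by move=> /xP[].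
have cx : {within [set theta | tc < theta], continuous x}.
  have xE' : {in [set theta | tc < theta], xx =1 x}.
    move=> theta; rewrite inE/= => th.
    have [_ _ _ [z [_ zu]]] := above _ th.
    by rewrite -(zu _ (xxP _ th)) (zu _ (xP _ th)).
  apply: (subspace_eq_continuous xE'); apply: continuous_subspaceW xxc.
  by move=> theta /= th; rewrite in_itv/= th.
(* Monotone and bounded below by 0, hence a right limit at the threshold. *)
have cS : cvg (S theta @[theta --> tc^'+]).
  apply: cvgP; apply: (@nondecreasing_at_right_cvgr _ S tc +oo%O) => //.
    move=> th1 th2; rewrite !in_itv/= !andbT => th1c th2c.
    rewrite le_eqVlt => /predU1P[->//|th12]; apply/ltW.
    apply: (power_sum_strictly_increasing (pos _ th1c) th12 (opt _ th1c) (opt _ th2c)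
      (first_largest_gt (fx _ th1c) (j := ord_max) isT)).
  exists 0 => z /= [theta + <-]; rewrite in_itv/= andbT => th.
  by apply: sumr_ge0 => r _; rewrite exprn_ge0// (opt _ th).1.1.
split=> // t /andP[yt t1].
(* Nothing is known of [x] at [tc] itself, so the search starts at some [th0] beyond [tc] where [S]
   is still below [t]; such a point exists because [t] exceeds the limit [y]. *)
have Slt : \forall theta \near tc^'+, S theta < t by exact: cvgr_lt cS _ yt.
have [th0 [S0t th0c]] := @filter_ex _ _ (at_right_proper_filter tc) _
  (filterI Slt (nbhs_right_gt tc)).
have above0 theta : th0 <= theta -> tc < theta by exact: lt_le_trans.
have [|||theta th0th Sth] := @power_sum_attained _ _ v.+1 0 x th0 t ord0.
- by move=> theta /above0/opt.
- by apply: continuous_subspaceW cx => theta /= /above0.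
- by rewrite t1 andbT ltW.
have th := above0 _ th0th.
exists theta; split=> // [theta' th' Sth'|].
  apply: (power_sum_inj (pos _ th') (pos _ th) (opt _ th') (opt _ th)).
  - exact: fx th'.
  - exact: fx th.
  - by rewrite Sth'.
by rewrite -Sth; apply: rate_function_maximizer (xP _ th).1.
Qed.
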